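(* Let $\lambda$ be a nonzero ordinal number, and assume that for each $\iota<\lambda$, $V_\iota$ is the $3$-dimensional vector space over a prime field $F_\iota$. Let $L$ be the direct product of the corresponding subspace lattices, that is, $$L:=\prod_{\iota<\lambda}\mathrm{Sub}(V_\iota).$$ Then $f^{\mathrm{mng}}(L)=4$ if and only if $\lambda$ is finite, $\lambda\neq 0$, and, up to isomorphism, each prime field occurs at most four times in the sequence $(F_\iota : \iota<\lambda)$.
   Context: For a lattice $A$, $f^{\mathrm{mng}}(A):=\min\{|X| : X \text{ is a generating set of } A\}$, where $X$ generates $A$ if no proper sublattice of $A$ (subset closed under binary joins and meets) contains $X$. $\mathrm{Sub}(V)$ is the lattice of all subspaces of the vector space $V$, ordered by inclusion. A prime field is a field with no proper subfield. *)

(* Defs.v *)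
From HB Require Import structures.
From mathcomp Require Import all_boot all_order all_algebra.
From mathcomp Require Import all_classical.
From mathcomp Require wochoice.
Set Implicit Arguments.
Unset Strict Implicit.
Unset Printing Implicit Defensive.
Import Order.TTheory GRing.Theory.
Local Open Scope classical_set_scope.
Local Open Scope card_scope.

Section Lattices.
Variables (d : Order.disp_t) (A : latticeType d).
Implicit Types S X : set A.

Definition sublattice S :=
  forall x y, S x -> S y -> S (x `&` y)%O /\ S (x `|` y)%O.

Definition generating X :=
  forall S, sublattice S -> X `<=` S -> S = [set: A].

(* The minimum ranges over cardinals, as a generating set may be infinite;
   the predicate says that this minimum is attained and equals n. *)
Definition fmng_eq (n : nat) :=
  (exists2 X, generating X & X #= `I_n) /\
  (forall X, generating X -> `I_n #<= X).

End Lattices.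

Section SubspaceLattice.
Variables (K : fieldType) (V : vectType K).

Fact vspace_display : Order.disp_t. Proof. exact: Order.default_display. Qed.

HB.instance Definition _ := Order.Le_isPOrder.Build vspace_display {vspace V}
  (@subvv K V) (@subv_anti K V) (@subv_trans K V).

Fact vspace_lexI (U W1 W2 : {vspace V}) :
  (U <= W1 :&: W2)%VS = (U <= W1)%VS && (U <= W2)%VS.
Proof. exact: subv_cap. Qed.

Fact vspace_leUx (U1 U2 W : {vspace V}) :
  (U1 + U2 <= W)%VS = (U1 <= W)%VS && (U2 <= W)%VS.
Proof. exact: subv_add. Qed.

HB.instance Definition _ := Order.POrder_MeetJoin_isLattice.Build
  vspace_display {vspace V} vspace_lexI vspace_leUx.

End SubspaceLattice.

(* An alias, because lattice instances on bare (dependent) function types would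
   clash with the instances of boolp on non-dependent ones. *)
Definition prod_lattice (I : Type) (d : Order.disp_t) (T : I -> latticeType d) :=
  forall i, T i.

Section ProductLattice.
Variables (I : Type) (d : Order.disp_t) (T : I -> latticeType d).
Local Notation L := (prod_lattice T).
Implicit Types f g h : L.

Fact prod_lattice_display : Order.disp_t.
Proof. exact: Order.default_display. Qed.

HB.instance Definition _ := gen_eqMixin L.
HB.instance Definition _ := gen_choiceMixin L.

Definition prod_le f g := `[< forall i, (f i <= g i)%O >].
Definition prod_meet f g : L := fun i => (f i `&` g i)%O.
Definition prod_join f g : L := fun i => (f i `|` g i)%O.

Fact prod_le_refl : reflexive prod_le.
Proof. by move=> f; apply/asboolP. Qed.

Fact prod_le_anti : antisymmetric prod_le.
Proof.
move=> f g /andP[/asboolP fg /asboolP gf].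
by apply: functional_extensionality_dep => i; apply: le_anti; rewrite fg gf.
Qed.

Fact prod_le_trans : transitive prod_le.
Proof.
move=> g f h /asboolP fg /asboolP gh; apply/asboolP => i.
exact: le_trans (fg i) (gh i).
Qed.

HB.instance Definition _ := Order.Le_isPOrder.Build prod_lattice_display L
  prod_le_refl prod_le_anti prod_le_trans.

Fact prod_lexI f g h : (f <= prod_meet g h)%O = (f <= g)%O && (f <= h)%O.
Proof.
apply/asboolP/andP => [fgh|[/asboolP fg /asboolP fh] i].
  by split; apply/asboolP => i; have := fgh i; rewrite lexI => /andP[].
by rewrite lexI fg fh.
Qed.

Fact prod_leUx f g h : (prod_join f g <= h)%O = (f <= h)%O && (g <= h)%O.
Proof.
apply/asboolP/andP => [fgh|[/asboolP fh /asboolP gh] i].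
  by split; apply/asboolP => i; have := fgh i; rewrite leUx => /andP[].
by rewrite leUx fh gh.
Qed.

HB.instance Definition _ := Order.POrder_MeetJoin_isLattice.Build
  prod_lattice_display L prod_lexI prod_leUx.

End ProductLattice.

Definition subspace_lattice (K : fieldType) (V : vectType K) :
  latticeType vspace_display := {vspace V}.

Definition prime_field (K : fieldType) :=
  forall S : {pred K}, divring_closed S -> S =i predT.

Definition field_isomorphic (K K' : fieldType) :=
  exists f : {rmorphism K -> K'}, bijective f.

(* Main.v *)
(** The set {g | f (g i) <= g j}, for a (semi)linear map f from V_i to V_j, is a
sublattice of the product. Requiring f to map A into B costs dim A * codim B
linear equations on the 9 entries of f. Counting them gives a nonscalar
endomorphism preserving three given subspaces, so three elements never generate,
and shows that in a generating quadruple every component is a point or a line.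
Two points and two lines are preserved by a rank one map, so each coordinate has
an odd one out among its four components; if two coordinates over isomorphic
fields have the same odd one out, the count yields a nonzero map between them.
Hence at most four coordinates share a field. The index set is finite because a
finitely generated lattice is countable.

Conversely, put the line x + y + z = 0 at position pi i and the three coordinate
points at the other positions, with pi injective on each isomorphism class. Von
Staudt's constructions make each coordinate projection full over a prime field.
Two coordinates are separated by a lattice term, using either their different
positions, or the term for the point (1 : n : 0) with n = 0 in one field
only. *)
Require Import Defs.
From HB Require Import structures.
From mathcomp Require Import all_boot all_order all_algebra.
From mathcomp Require Import all_classical.
From mathcomp Require wochoice.
From mathcomp Require Import zify ring.
Set Implicit Arguments.
Unset Strict Implicit.
Unset Printing Implicit Defensive.
Import Order.TTheory GRing.Theory VectorInternalTheory.
Local Open Scope classical_set_scope.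
Local Open Scope card_scope.
Local Open Scope ring_scope.

(** * Sublattices defined by linear maps *)

(** Each condition says that a linear map from [f] to matrices of size [\rank (A k)] by
    [n - \rank (B k)] vanishes, so imposing it lowers the dimension by at most the product of the
    two. *)
Lemma constrained_mx_space (K : fieldType) m n (I : Type) (r : seq I)
    (A : I -> 'M[K]_m) (B : I -> 'M[K]_n) :
  exists2 U : {vspace 'M[K]_(m, n)},
    (m * n <= \dim U + \sum_(k <- r) \rank (A k) * (n - \rank (B k)))%N &
    forall f, f \in U -> all (fun k => (A k *m f <= B k)%MS) r.
Proof.
elim: r => [|k r [U dimU subU]].
  by exists fullv => [|f _ //]; rewrite big_nil addn0 dimvf /dim /=.
pose C := cokermx (B k).
pose phi (f : 'M[K]_(m, n)) := row_base (A k) *m f *m col_base C.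
have phi_lin : linear phi.
  by move=> a f g; rewrite /phi mulmxDr mulmxDl -scalemxAr -scalemxAl.
pose phiL := linfun
  (HB.pack phi (GRing.isLinear.Build _ _ _ _ phi phi_lin) : {linear _ -> _}).
have phiLE f : phiL f = phi f by rewrite lfunE.
exists (U :&: lker phiL)%VS => [|f].
  have dim_img : (\dim (phiL @: U) <= \rank (A k) * (n - \rank (B k)))%N.
    rewrite -mxrank_coker.
    by have := dimvS (subvf (phiL @: U)%VS); rewrite [in X in (_ <= X)%N]dimvf.
  rewrite big_cons addnA.
  apply: leq_trans dimU _; rewrite leq_add2r -(limg_ker_dim phiL U).
  by rewrite leq_add2l.
rewrite memv_cap memv_ker phiLE => /andP[fU /eqP phif0] /=.
rewrite subU // andbT submxE -/C.
have -> : A k *m f *m C = col_base (A k) *m phi f *m row_base C.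
  rewrite -[in LHS](mulmx_base (A k)) -[in LHS](mulmx_base C) /phi.
  by rewrite !mulmxA.
by rewrite phif0 mulmx0 mul0mx.
Qed.

(** Unit vectors being eigenvectors makes [f] diagonal; sums of two unit vectors make its diagonal
    entries equal. *)
Lemma scalar_mx_invariant (K : fieldType) n (f : 'M[K]_n) :
  (forall v : 'rV_n, (v *m f <= v)%MS) -> is_scalar_mx f.
Proof.
move=> inv_f; apply/is_scalar_mxP.
have offdiag i j : i != j -> f i j = 0.
  move=> neq_ij; have /sub_rVP[a /rowP/(_ j)] := inv_f (delta_mx 0 i).
  by rewrite -rowE !mxE eqxx eq_sym (negbTE neq_ij) mulr0.
have diag i j : i != j -> f i i = f j j.
  move=> neq_ij.
  have /sub_rVP[a /rowP fa] := inv_f (delta_mx 0 i + delta_mx 0 j).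
  have := fa j; have := fa i; rewrite mulmxDl -!rowE !mxE !eqxx /=.
  rewrite [j == i]eq_sym (negbTE neq_ij) (offdiag _ _ neq_ij).
  rewrite (offdiag j i) 1?eq_sym // !(addr0, add0r) !mulr1 => -> ->.
  by [].
case: n f inv_f offdiag diag => [|n] f _ offdiag diag.
  by exists 0; apply/matrixP => -[].
exists (f 0 0); apply/matrixP => i j; rewrite mxE.
have [<-|/offdiag//] := eqVneq i j.
by have [->|/diag] := eqVneq i 0.
Qed.

Lemma mulmx_delta_neq0 (K : fieldType) m n p q (A : 'M[K]_(m, n))
    (B : 'M[K]_(p, q)) :
  A != 0 -> B != 0 -> exists b c, A *m delta_mx b c *m B != 0.
Proof.
have ex_entry m' n' (C : 'M[K]_(m', n')) : C != 0 -> exists a b, C a b != 0.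
  apply: contra_neqP => /forallNP C0; apply/matrixP => a b; rewrite mxE.
  by have /forallNP/(_ b)/negP/negbNE/eqP := C0 a.
move=> /ex_entry[a [b Aab]] /ex_entry[c [d Bcd]]; exists b, c.
apply: contraNneq (mulf_neq0 Aab Bcd) => /matrixP/(_ a d).
rewrite mxE (bigD1 c) //= big1 => [|e ne]; last first.
  rewrite mxE big1 ?mul0r // => e' _.
  by rewrite mxE (negbTE ne) andbF mulr0.
rewrite mxE (bigD1 b) //= big1 => [|e ne]; last first.
  by rewrite mxE (negbTE ne) mulr0.
by rewrite !mxE !eqxx !addr0 mulr1 => ->.
Qed.

Section VspaceMatrix.
Variables (K : fieldType) (V : vectType K).
Implicit Types U W : {vspace V}.

Lemma vs2mxD U W : vs2mx (U + W)%VS = (vs2mx U + vs2mx W)%MS.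
Proof. by rewrite /= genmx_adds !gen_vs2mx. Qed.

Lemma vs2mxI U W : vs2mx (U :&: W)%VS = (vs2mx U :&: vs2mx W)%MS.
Proof. by rewrite /= genmx_cap !gen_vs2mx. Qed.

End VspaceMatrix.

Section SemilinearSublattice.
Variables (I : Type) (F : I -> fieldType) (V : forall i, vectType (F i)).
Local Notation L := (prod_lattice (fun i => subspace_lattice (V i))).
Implicit Types (X : set L) (g h : L).

(* [f] together with the embeddings of both fields into [K] plays the role of a
   semilinear map from [V i] to [V j], applied to the row spaces [vs2mx]. *)
Definition mx_sublattice (i j : I) (K : fieldType)
    (s : {rmorphism F i -> K}) (s' : {rmorphism F j -> K})
    (f : 'M[K]_(dim (V i), dim (V j))) : set L :=
  [set g : L | (map_mx s (vs2mx (g i)) *m f <= map_mx s' (vs2mx (g j)))%MS].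

Lemma mx_sublatticeP i j K s s' f : sublattice (@mx_sublattice i j K s s' f).
Proof.
move=> g h; rewrite /mx_sublattice /= => gS hS; split.
  change (map_mx s (vs2mx (g i :&: h i)) *m f
          <= map_mx s' (vs2mx (g j :&: h j)))%MS.
  rewrite !vs2mxI map_capmx sub_capmx; apply/andP; split.
    by apply: submx_trans gS; apply: submxMr; rewrite map_submx capmxSl.
  by apply: submx_trans hS; apply: submxMr; rewrite map_submx capmxSr.
change (map_mx s (vs2mx (g i + h i)) *m f <= map_mx s' (vs2mx (g j + h j)))%MS.
by rewrite !vs2mxD (eqmxMr _ (map_addsmx _ _ _)) map_addsmx addsmxMr addsmxS.
Qed.

(** The sublattice is tested on the element that is the whole space at [i] and zero elsewhere. *)
Lemma generating_hom0 X (i j : I) (K : fieldType)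
    (s : {rmorphism F i -> K}) (s' : {rmorphism F j -> K})
    (f : 'M[K]_(dim (V i), dim (V j))) :
  generating X -> i <> j -> X `<=` mx_sublattice s s' f -> f = 0.
Proof.
move=> genX neq_ij /(genX _ (@mx_sublatticeP i j K s s' f)) ST.
pose g : L := fun k => if `[< k = i >] then fullv else 0%VS.
have : mx_sublattice s s' f g by rewrite ST.
rewrite /mx_sublattice /g /=; case: asboolP => // _.
case: asboolP => [/esym//|_].
rewrite (_ : vs2mx 0%VS = 0) ?map_mx0 ?submx0; last first.
  by rewrite /= linear0 genmx0.
rewrite (_ : vs2mx fullv = 1%:M) ?map_mx1 ?mul1mx => [/eqP|] //.
by rewrite /= genmx1.
Qed.

(** The sublattice is everything, so every line through the origin occurs at [i]; thus [f] maps each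
    vector into its own span. *)
Lemma generating_endo X (i : I) (f : 'M[F i]_(dim (V i))) :
  generating X ->
  (forall g, X g -> (vs2mx (g i) *m f <= vs2mx (g i))%MS) -> is_scalar_mx f.
Proof.
move=> genX Xf; have ST : mx_sublattice (@idfun (F i)) (@idfun (F i)) f = setT.
  apply: genX; first exact: mx_sublatticeP.
  by move=> g /Xf; rewrite /mx_sublattice /= !map_mx_id.
apply: scalar_mx_invariant => v.
pose g : L := fun k =>
  if pselect (i = k) is left e then ecast k {vspace V k} e (mx2vs v) else 0%VS.
have : mx_sublattice (@idfun (F i)) (@idfun (F i)) f g by rewrite ST.
rewrite /mx_sublattice /g /= !map_mx_id //; case: pselect => // e.
rewrite (Prop_irrelevance e erefl) /=.
by rewrite (eqmxMr _ (mx2vsK v)) mx2vsK.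
Qed.

(** Otherwise some rank one [f] kills [P] and has its image in [N]; it preserves [g i] for every [g]
    in [X], yet is not scalar in dimension above one. *)
Lemma generating_no_rank1 X i (P N : {vspace V i}) :
  generating X -> (1 < \dim {:V i})%N -> P != fullv -> N != 0%VS ->
  ~ (forall g, X g -> (g i <= P)%VS || (N <= g i)%VS).
Proof.
rewrite dimvf => genX dimV P_proper N_neq0 XPN.
have C_neq0 : cokermx (vs2mx P) != 0.
  apply: contraNneq P_proper => C0.
  by rewrite eqEsubv subvf /= /subsetv submxE C0 mulmx0.
have N_neq0' : vs2mx N != 0.
  apply: contraNneq N_neq0 => N0; apply/eqP/val_inj.
  by rewrite /= linear0 genmx0.
have [b [c f_neq0]] := mulmx_delta_neq0 C_neq0 N_neq0'.
set f := _ *m _ in f_neq0.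
have /is_scalar_mxP[x fx] : is_scalar_mx f.
  apply: generating_endo genX _ => g /XPN /orP[gP|Ng].
    have /eqP gP0 : vs2mx (g i) *m cokermx (vs2mx P) == 0 by rewrite -submxE.
    by rewrite /f 2!mulmxA gP0 !mul0mx sub0mx.
  by rewrite /f mulmxA; apply: submx_trans (submxMl _ _) Ng.
have : (\rank f <= 1)%N.
  apply: leq_trans (mxrankM_maxl _ _) _; apply: leq_trans (mxrankM_maxr _ _) _.
  by rewrite mxrank_delta.
have x_neq0 : x != 0 by apply: contraNneq f_neq0 => x0; rewrite fx x0 raddf0.
by rewrite fx -scalemx1 mxrank_scale_nz // mxrank1 leqNgt dimV.
Qed.

Section Counting.
Hypothesis V_dim3 : forall i, \dim {:V i} = 3%N.
Variables (X : set L) (n : nat) (t : 'I_n -> L).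
Hypotheses (genX : generating X) (Xt : X `<=` range t).

Let dimV i : dim (V i) = 3%N. Proof. by rewrite -(V_dim3 i) dimvf. Qed.

(** At most eight linear equations on nine entries would leave a nonzero [f]. *)
Lemma dim_hom_gt8 (i j : I) (K : fieldType)
    (s : {rmorphism F i -> K}) (s' : {rmorphism F j -> K}) :
  i <> j ->
  (8 < \sum_k \dim (t k i : {vspace V i}) *
              (3 - \dim (t k j : {vspace V j})))%N.
Proof.
move=> neq_ij; rewrite ltnNge; apply/negP; set C := (\sum_k _)%N => count.
have [U dimU subU] := constrained_mx_space (index_enum 'I_n)
  (fun k => map_mx s (vs2mx (t k i))) (fun k => map_mx s' (vs2mx (t k j))).
have: (0 < \dim U)%N.
  move: dimU; set S := (\sum_(k <- _) _)%N; suff -> : S = C.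
    move=> dimU; have : (9 <= \dim U + C)%N; last by lia.
    by apply: leq_trans dimU; rewrite !dimV.
  apply: eq_bigr => k _; rewrite !mxrank_map.
  by congr (_ * (_ - _))%N; apply: dimV.
rewrite lt0n dimv_eq0 -vpick0 => /eqP[].
apply: (@generating_hom0 X i j K s s') => //.
move=> _ /Xt[k _ <-]; have /allP := subU _ (memv_pick U).
by apply; rewrite mem_index_enum.
Qed.

(** Scalars always solve the equations, so a nonscalar solution takes a solution space of dimension
    two: hence seven instead of eight. *)
Lemma dim_endo_gt7 (i : I) :
  (7 < \sum_k \dim (t k i : {vspace V i}) *
              (3 - \dim (t k i : {vspace V i})))%N.
Proof.
rewrite ltnNge; apply/negP; set C := (\sum_k _)%N => count.
have [U dimU subU] := constrained_mx_space (index_enum 'I_n)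
  (fun k => vs2mx (t k i)) (fun k => vs2mx (t k i)).
have U_gt1 : (1 < \dim U)%N.
  move: dimU; set S := (\sum_(k <- _) _)%N; suff -> : S = C.
    move=> dimU; have : (9 <= \dim U + C)%N; last by lia.
    by apply: leq_trans dimU; rewrite !dimV.
  by apply: eq_bigr => k _; congr (_ * (_ - _))%N; apply: dimV.
have: ~~ (U <= <[1%:M]>)%VS.
  apply: contraL U_gt1 => /dimvS; rewrite dim_vline -leqNgt => /leq_trans-> //.
  exact: leq_b1.
case/subvPn => f fU /vlineP[].
have /is_scalar_mxP[x ->] : is_scalar_mx f.
  apply: generating_endo genX _ => _ /Xt[k _ <-].
  by have /allP := subU _ fU; apply; rewrite mem_index_enum.
by exists x; rewrite scalemx1.
Qed.

End Counting.

End SemilinearSublattice.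

(** * Generating quadruples *)

Lemma card_le_injfun T U (x0 : T) (A : set U) (B : set T) :
  A #<= B -> exists2 f : U -> T, set_fun A B f & set_inj A f.
Proof.
move: x0; elim/Ppointed: T => T in B * => x0; first by case: (no x0).
by move=> /pcard_leP/injfunPex.
Qed.

Lemma card_leI_or T (A : set T) n : (A #<= `I_n) \/ (`I_n.+1 #<= A).
Proof.
have [[m Am]|/infiniteP natA] := pselect (finite_set A); last first.
  by right; apply: card_le_trans natA; exact: card_leT.
rewrite (card_le_eql Am) (card_le_eqr Am) !card_le_II.
by case: (leqP m n) => H; [left|right].
Qed.

Lemma card_le_sub_range T (x0 : T) (A : set T) n :
  A #<= `I_n -> exists t : 'I_n -> T, A `<=` range t.
Proof.
case/pfcard_geP => [->|/surjfunPex[f ->]]; first by exists (fun=> x0).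
by exists (fun i => f i) => _ [i /= ltin <-]; exists (Ordinal ltin).
Qed.

Section Bigcap.
Variables (K : fieldType) (V : vectType K) (I : Type).

Lemma dim_bigcapv_ge (r : seq I) (P : pred I) (U : I -> {vspace V}) :
  (\dim {:V} <= \dim (\bigcap_(k <- r | P k) U k)%VS +
     \sum_(k <- r | P k) (\dim {:V} - \dim (U k)))%N.
Proof.
elim: r => [|k r IH]; first by rewrite !big_nil addn0.
rewrite !big_cons; case: (P k) => //.
have := dimv_sum_cap (U k) (\bigcap_(k <- r | P k) U k)%VS.
have := dimvS (subvf (U k + \bigcap_(k <- r | P k) U k)%VS).
have := dimvS (subvf (U k)).
move: IH; lia.
Qed.

End Bigcap.

(* The four booleans tell which components of a quadruple are lines (the others
   are points). *)
Definition odd_one (b : bool * bool * bool * bool) : nat :=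
  let: (b0, b1, b2, b3) := b in
  if (b0 + b1 + b2 + b3 == 1)%N then index true [:: b0; b1; b2; b3]
  else if (b0 + b1 + b2 + b3 == 3)%N then index false [:: b0; b1; b2; b3]
  else 0.

Lemma odd_one_lt4 b : (odd_one b < 4)%N.
Proof. by case: b => [[[[] []] []] []]. Qed.

(* The sum of [dim A * codim B] over the four components [A] of type [b] and [B]
   of type [c]. *)
Definition hom_bound (b c : bool * bool * bool * bool) : nat :=
  let: (b0, b1, b2, b3) := b in let: (c0, c1, c2, c3) := c in
  (b0.+1 * (2 - c0) + b1.+1 * (2 - c1) + b2.+1 * (2 - c2) + b3.+1 * (2 - c3))%N.

Definition weight (b : bool * bool * bool * bool) : nat :=
  let: (b0, b1, b2, b3) := b in (b0 + b1 + b2 + b3)%N.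

(** Types of weight 0 or 4 satisfy a bound against every type, so the default 0 of [odd_one] does no
    harm there. For weights 1 and 3, a common odd position gives 8 when the weights agree, and 7 in
    one direction when they differ. *)
Lemma odd_one_comparable b c :
  weight b != 2 -> weight c != 2 -> odd_one b = odd_one c ->
  (hom_bound b c <= 8)%N || (hom_bound c b <= 8)%N.
Proof. by move: b c => [[[[] []] []] []] [[[[] []] []] []]. Qed.

Section Necessity.
Variables (I : Type) (F : I -> fieldType) (V : forall i, vectType (F i)).
Hypothesis V_dim3 : forall i, \dim {:V i} = 3%N.
Local Notation L := (prod_lattice (fun i => subspace_lattice (V i))).
Implicit Types (X : set L).

Lemma dimv_le3 i (U : {vspace V i}) : (\dim U <= 3)%N.
Proof. by have := dimvS (subvf U); rewrite V_dim3. Qed.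

(** A subspace of dimension k contributes k(3 - k), which is at most 2, so three generators give at
    most 6 equations. *)
Lemma generating_card_ge4 (i : I) X : generating X -> `I_4 #<= X.
Proof.
move=> genX; case: (card_leI_or X 3) => // /(card_le_sub_range (fun=> 0%VS)).
move=> [t Xt]; have := dim_endo_gt7 V_dim3 genX Xt i.
have: (\sum_(k < 3) \dim (t k i : {vspace V i}) *
         (3 - \dim (t k i : {vspace V i})) <= \sum_(k < 3) 2)%N.
  apply: leq_sum => k _; have := dimv_le3 (t k i).
  by case: (\dim _) => [|[|[|[|]]]].
by rewrite sum_nat_const card_ord => le6 /leq_trans/(_ le6).
Qed.

Section FourGenerators.
Variables (X : set L) (t : 'I_4 -> L).
Hypotheses (genX : generating X) (Xt : X `<=` range t).

Let d i k := \dim (t k i : {vspace V i}).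
Definition generator_type i : bool * bool * bool * bool :=
  (d i ord0 == 2, d i (inord 1) == 2, d i (inord 2) == 2, d i (inord 3) == 2).

Let sum4 (f : 'I_4 -> nat) :
  (\sum_k f k = f ord0 + f (inord 1) + f (inord 2) + f (inord 3))%N.
Proof.
rewrite !big_ord_recl big_ord0 addn0 !addnA.
by congr (_ + f _ + f _ + f _)%N; apply/val_inj; rewrite /= inordK.
Qed.

(** A zero or full component contributes no equation, and the other three at most 6. *)
Lemma generator_dim12 i k : (d i k == 1) || (d i k == 2).
Proof.
have := dim_endo_gt7 V_dim3 genX Xt i.
rewrite (bigD1 k) //= -/(d i k); set S := (\sum_(_ < _ | _) _)%N.
have : (S <= \sum_(k' < 4 | k' != k) 2)%N.
  apply: leq_sum => k' _; have := dimv_le3 (t k' i).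
  by case: (\dim _) => [|[|[|[|]]]].
rewrite sum_nat_const cardC1 card_ord.
have: (d i k <= 3)%N := dimv_le3 (t k i).
by move: S; case: (d i k) => [|[|[|[|]]]] //= S; lia.
Qed.

Lemma generator_dimE i k : d i k = (d i k == 2).+1.
Proof. by have /orP[/eqP->|/eqP->] := generator_dim12 i k. Qed.

Lemma generator_type_weight i : weight (generator_type i) != 2.
Proof.
have -> : weight (generator_type i) = (\sum_k (d i k == 2))%N by rewrite sum4.
apply/eqP => w2.
(* [P] joins the two points, so it has dimension at most 2; [N] is the meet of the two lines, so it
   is nonzero. Every generator lies below [P] or above [N] at [i]. *)
pose P : {vspace V i} := (\sum_(k | d i k != 2) (t k i : {vspace V i}))%VS.
pose N : {vspace V i} := (\bigcap_(k | d i k == 2) (t k i : {vspace V i}))%VS.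
have w1 : (\sum_k (d i k != 2) = 2)%N.
  have : (\sum_k ((d i k == 2) + (d i k != 2)) = \sum_(k < 4) 1)%N.
    by apply: eq_bigr => k _; case: eqP.
  by rewrite big_split /= w2 sum_nat_const card_ord; lia.
apply: (@generating_no_rank1 _ _ _ X i P N) => //.
- by rewrite V_dim3.
- apply: contraTneq isT => Pfull; have := V_dim3 i; rewrite -Pfull => dimP.
  have := dimv_leq_sum (index_enum 'I_4) (fun k => d i k != 2)
    (fun k => t k i : {vspace V i}).
  rewrite -/P dimP (eq_bigr (fun=> 1%N)) => [|k dk].
    rewrite (_ : \sum_(_ <- _ | _) _ = 2)%N // -[RHS]w1 big_mkcond.
    by apply: eq_bigr => k _; case: eqP.
  by have /orP[/eqP //|] := generator_dim12 i k; rewrite (negbTE dk).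
- rewrite -dimv_eq0; apply/eqP => dimN.
  have := dim_bigcapv_ge (index_enum 'I_4) (fun k => d i k == 2)
    (fun k => t k i : {vspace V i}).
  rewrite -/N dimN V_dim3 (eq_bigr (fun=> 1%N)) => [|k /eqP dk].
    rewrite (_ : \sum_(_ <- _ | _) _ = 2)%N // -[RHS]w2 big_mkcond.
    by apply: eq_bigr => k _; case: eqP.
  by rewrite -/(d i k) dk.
move=> _ /Xt[k _ <-].
have [dk|dk] := boolP (d i k == 2); apply/orP; [right|left].
  exact: (@bigcapv_inf _ _ _ k _ _ _ dk).
by apply: (sumv_sup k).
Qed.

(** For distinct [i] and [j], at most eight equations would arise in one of the two directions. The
    field [K] hosts the matrix entries of the semilinear map. *)
Lemma equal_type_iso (K : fieldType) i j
    (s : {rmorphism F i -> K}) (s' : {rmorphism F j -> K}) :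
  odd_one (generator_type i) = odd_one (generator_type j) -> i = j.
Proof.
move=> eq_type; apply/not_notP => neq_ij.
have neq_ji : j <> i by move=> e; apply: neq_ij.
have homE i' j' : (\sum_k \dim (t k i' : {vspace V i'}) *
                     (3 - \dim (t k j' : {vspace V j'})) =
                   hom_bound (generator_type i') (generator_type j'))%N.
  rewrite sum4 /= -!/(d _ _); do 4!rewrite -generator_dimE.
  by do 4?congr (_ + _)%N; rewrite [in LHS](generator_dimE j') subSS.
have := odd_one_comparable (generator_type_weight i) (generator_type_weight j)
  eq_type.
have := dim_hom_gt8 V_dim3 genX Xt s s' neq_ij.
have := dim_hom_gt8 V_dim3 genX Xt s' s neq_ji.
by rewrite !homE => h1 h2; rewrite leqNgt h2 leqNgt h1.
Qed.

End FourGenerators.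
End Necessity.

(** * Countability of the lattice and finiteness of the index set *)

Section Countable.
Variables (d : Order.disp_t) (A : latticeType d) (n : nat) (t : 'I_n -> A).
Variable (a0 : A).

Fixpoint lattice_term_eval (w : GenTree.tree 'I_n) : A :=
  match w with
  | GenTree.Leaf k => t k
  | GenTree.Node m [:: u; v] =>
      if m is 0 then (lattice_term_eval u `&` lattice_term_eval v)%O
      else (lattice_term_eval u `|` lattice_term_eval v)%O
  | _ => a0
  end.

(** Every element is the value of a lattice term in the generators, and finite trees with leaves in
    a finite type are countable. *)
Lemma generating_countable (X : set A) :
  generating X -> X `<=` range t -> countable [set: A].
Proof.
move=> genX Xt; have <- : range lattice_term_eval = [set: A].
  apply: genX => [_ _ [u _ <-] [v _ <-]|_ /Xt[k _ <-]]; last first.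
    by exists (GenTree.Leaf k).
  split; first by exists (GenTree.Node 0 [:: u; v]).
  by exists (GenTree.Node 1 [:: u; v]).
by apply: sub_countable (card_image_le _ _) _; apply: countableP.
Qed.

End Countable.

Section Infinite.
Variables (I : Type) (F : I -> fieldType) (V : forall i, vectType (F i)).
Hypothesis V_dim3 : forall i, \dim {:V i} = 3%N.
Local Notation L := (prod_lattice (fun i => subspace_lattice (V i))).

(** On an infinite index set, [iota] after [q] would inject the product into its own index set,
    although each factor has two distinct elements. *)
Lemma countable_prod_finite (i0 : I) :
  countable [set: L] -> finite_set [set: I].
Proof.
move=> /countable_injP[q q_inj]; apply: contrapT => /infiniteP.
move=> /(card_le_injfun i0)[iota _ iota_inj].
(* Cantor's diagonal argument. *)
pose g : L := fun i =>
  if `[< exists h : L, i = iota (q h) /\ h i = 0%VS >] then fullv else 0%VS.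
have full_neq0 i : fullv <> 0%VS :> {vspace V i}.
  by move=> e; have := V_dim3 i; rewrite e dimv0.
have gE : g (iota (q g)) =
    if `[< exists h : L, iota (q g) = iota (q h) /\ h (iota (q g)) = 0%VS >]
    then fullv else 0%VS by [].
move: gE; case: asboolP => [[h [/iota_inj e h0]]|no_h] gE.
  have hg : h = g by apply: q_inj; rewrite ?inE //; apply/esym/e; rewrite inE.
  by case: (full_neq0 (iota (q g))); rewrite -gE -h0 hg.
by case: no_h; exists g.
Qed.

End Infinite.

Lemma fmng4_necessary (I : Type) (F : I -> fieldType)
    (V : forall i, vectType (F i)) (V_dim3 : forall i, \dim {:V i} = 3%N)
    (i0 : I) :
  fmng_eq (prod_lattice (fun i => subspace_lattice (V i))) 4 ->
  finite_set [set: I] /\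
  (forall K : fieldType, [set i | field_isomorphic (F i) K] #<= `I_4).
Proof.
move=> [[X genX X4] _].
have [t Xt] : exists t : 'I_4 -> _, X `<=` range t.
  apply: (card_le_sub_range (fun i => 0%VS : subspace_lattice (V i))).
  by rewrite (card_le_eql X4).
split.
  apply: (@countable_prod_finite I F V V_dim3 i0).
  exact: (@generating_countable _ _ 4 t
            (fun i => 0%VS : subspace_lattice (V i)) X).
move=> K; case: (card_leI_or [set i | field_isomorphic (F i) K] 4) => //.
move=> /(card_le_injfun i0)[f f_iso f_inj].
(* Pigeonhole: five coordinates over copies of [K] would need five different odd positions among
   four. *)
have [c c_inj] : exists c : 'I_5 -> 'I_4, injective c.
  exists (fun m => Ordinal (odd_one_lt4 (generator_type t (f m)))).
  move=> m m' /(congr1 val) /= e.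
  have [s _] : field_isomorphic (F (f m)) K by apply: f_iso => /=.
  have [s' _] : field_isomorphic (F (f m')) K by apply: f_iso => /=.
  apply/val_inj/f_inj; rewrite ?inE //=.
  exact: (equal_type_iso V_dim3 genX Xt s s').
by have := leq_card c c_inj; rewrite !card_ord.
Qed.

(** * Prime fields of equal characteristic *)

(** Equality of characteristics, phrased so that its failure yields a number vanishing in exactly
    one of the fields. *)
Definition same_char (K K' : fieldType) :=
  forall n, (n%:R == 0 :> K) = (n%:R == 0 :> K').

(** The fractions of integers already form a subfield. *)
Lemma prime_field_ratio (K : fieldType) : prime_field K ->
  forall a : K, exists x y : int, y%:~R != 0 :> K /\ a = x%:~R / y%:~R.
Proof.
move=> K_prime a.
pose S := [pred b : K |
  `[< exists x y : int, y%:~R != 0 :> K /\ b = x%:~R / y%:~R >]].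
suff /K_prime/(_ a) : divring_closed S by rewrite !inE => /asboolP.
split; first by apply/asboolP; exists 1, 1; rewrite divr1 oner_neq0.
  move=> _ _ /asboolP[x [y [y0 ->]]] /asboolP[x' [y' [y'0 ->]]]; apply/asboolP.
  exists (x * y' - x' * y), (y * y'); rewrite rmorphB !rmorphM mulf_neq0 //.
  by split=> //=; field; rewrite ?y0 ?y'0.
move=> _ _ /asboolP[x [y [y0 ->]]] /asboolP[x' [y' [y'0 ->]]]; apply/asboolP.
(* Division by zero gives 0, which is represented as 0/1. *)
have [x'0|x'0] := eqVneq (x'%:~R : K) 0.
  by exists 0, 1; rewrite oner_neq0 x'0 mul0r invr0 mulr0 mulr0z mul0r.
exists (x * y'), (y * x'); rewrite !rmorphM mulf_neq0 //.
by split=> //=; field; rewrite ?y0 ?x'0 ?y'0.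
Qed.

Section SameChar.
Variables K K' : fieldType.
Hypotheses (K_prime : prime_field K) (K'_prime : prime_field K').
Hypothesis KK' : same_char K K'.

Lemma same_char_intr (z : int) : (z%:~R == 0 :> K) = (z%:~R == 0 :> K').
Proof.
by case: z => n; first exact: KK'; rewrite NegzE !mulrNz !oppr_eq0; apply: KK'.
Qed.

Definition ratio_map (a : K) : K' :=
  let: exist x e := cid (prime_field_ratio K_prime a) in
  let: exist y _ := cid e in x%:~R / y%:~R.

(** The chosen representation is immaterial: equality of two fractions is the vanishing of an
    integer, which both fields detect alike. *)
Lemma ratio_mapE (x y : int) : y%:~R != 0 :> K ->
  ratio_map (x%:~R / y%:~R) = x%:~R / y%:~R.
Proof.
move=> y0; rewrite /ratio_map; case: cid => x' e; case: cid => y' [y'0 /eqP].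
rewrite eqr_div // -!rmorphM -subr_eq0 -rmorphB same_char_intr rmorphB subr_eq0.
by rewrite !rmorphM -eqr_div -?same_char_intr // => /eqP.
Qed.
End SameChar.

Lemma same_char_isomorphic (K K' : fieldType) :
  prime_field K -> prime_field K' -> same_char K K' -> field_isomorphic K K'.
Proof.
move=> Kp K'p KK'; have K'K : same_char K' K by move=> n; rewrite KK'.
pose f := ratio_map K' Kp; pose g := ratio_map K K'p.
have fE := ratio_mapE Kp KK'; have gE := ratio_mapE K'p K'K.
have charE := same_char_intr KK'.
have fB : zmod_morphism f.
  move=> a b.
  have [x [y [y0 ->]]] := prime_field_ratio Kp a.
  have [x' [y' [y'0 ->]]] := prime_field_ratio Kp b.
  have -> : x%:~R / y%:~R - x'%:~R / y'%:~R =
            (x * y' - x' * y)%:~R / (y * y')%:~R :> K.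
    by rewrite rmorphB !rmorphM /=; field; rewrite ?y0 ?y'0.
  rewrite /f !fE ?rmorphM ?mulf_neq0 // rmorphB !rmorphM /=.
  by move: y0 y'0; rewrite !charE => y0 y'0; field; rewrite ?y0 ?y'0.
have fM : monoid_morphism f.
  split; first by have := fE 1 1 (oner_neq0 _); rewrite !divr1.
  move=> a b.
  have [x [y [y0 ->]]] := prime_field_ratio Kp a.
  have [x' [y' [y'0 ->]]] := prime_field_ratio Kp b.
  have -> : x%:~R / y%:~R * (x'%:~R / y'%:~R) =
            (x * x')%:~R / (y * y')%:~R :> K.
    by rewrite !rmorphM /=; field; rewrite ?y0 ?y'0.
  rewrite /f !fE ?rmorphM ?mulf_neq0 //= .
  by move: y0 y'0; rewrite !charE => y0 y'0; field; rewrite ?y0 ?y'0.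
exists (HB.pack f (GRing.isZmodMorphism.Build K K' f fB)
  (GRing.isMonoidMorphism.Build K K' f fM) : {rmorphism K -> K'}).
exists g => a /=.
  have [x [y [y0 ->]]] := prime_field_ratio Kp a.
  by rewrite /f /g fE // gE // -charE.
have [x [y [y0 ->]]] := prime_field_ratio K'p a.
by rewrite /f /g gE // fE // charE.
Qed.

(** * Coordinates in the projective plane *)

Section LatticeTerms.
Variables (d : Order.disp_t) (A : latticeType d).
Implicit Types (x y z l p q r s w : A) (S : set A).
Local Open Scope order_scope.

(* In the terms below [x], [y], [z] stand for the coordinate points and [l] for
   the line x + y + z = 0; [term_move] projects the axis [xy] to [xz] from the
   point of [l] on [yz], sending (1 : a : 0) to (1 : 0 : a), and the next two
   subtract and divide the coordinates of points (1 : a : 0) and (1 : b : 0). *)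
Definition term_move x y z l p := (p `|` (l `&` (y `|` z))) `&` (x `|` z).

Definition term_sub x y z l p q :=
  (((p `|` (l `&` (y `|` z))) `&` (term_move x y z l q `|` y)) `|` z)
  `&` (x `|` y).

Definition term_div x y z l p q :=
  term_move y z x l
    (((((p `|` z) `&` (term_move x y z l q `|` y))) `|` x) `&` (y `|` z)).

(* Sends 0 to 0 and the point [x] to the whole plane. *)
Definition term_spread x y z l w :=
  w `|` ((w `|` (l `&` (x `|` y))) `&` y) `|` ((w `|` (l `&` (x `|` z))) `&` z).

Definition term_sep_axis l r s :=
  ((r `|` (l `&` (r `|` s))) `&` s) `|` ((s `|` (l `&` (r `|` s))) `&` r).

(* Evaluates to the whole plane if [l] is a line in general position to the
   triangle [q], [r], [s], and to 0 if [q] is one to the triangle [l], [r], [s]. *)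
Definition term_sep l q r s :=
  term_sep_axis l r s `|` ((term_sep_axis l r s `|` q) `&` l).

Section Closed.
Variables (S : set A) (subS : sublattice S).

Lemma sublatticeI x y : S x -> S y -> S (x `&` y).
Proof. by move=> Sx /(subS Sx)[]. Qed.

Lemma sublatticeU x y : S x -> S y -> S (x `|` y).
Proof. by move=> Sx /(subS Sx)[]. Qed.

Local Ltac closed :=
  repeat first [assumption | apply: sublatticeI | apply: sublatticeU].

Lemma sublattice_move x y z l p :
  S x -> S y -> S z -> S l -> S p -> S (term_move x y z l p).
Proof. by move=> *; rewrite /term_move; closed. Qed.

Lemma sublattice_sub x y z l p q :
  S x -> S y -> S z -> S l -> S p -> S q -> S (term_sub x y z l p q).
Proof. by move=> *; rewrite /term_sub /term_move; closed. Qed.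

Lemma sublattice_div x y z l p q :
  S x -> S y -> S z -> S l -> S p -> S q -> S (term_div x y z l p q).
Proof. by move=> *; rewrite /term_div /term_move; closed. Qed.

Lemma sublattice_spread x y z l w :
  S x -> S y -> S z -> S l -> S w -> S (term_spread x y z l w).
Proof. by move=> *; rewrite /term_spread; closed. Qed.

Lemma sublattice_sep l q r s :
  S l -> S q -> S r -> S s -> S (term_sep l q r s).
Proof. by move=> *; rewrite /term_sep /term_sep_axis; closed. Qed.

End Closed.
End LatticeTerms.

(* Lines will be given by normal vectors, so that joins of points and meets of
   lines are both cross products. *)
Definition nz (K : fieldType) (a b c : K) := [|| a != 0, b != 0 | c != 0].

(** Eliminating one unknown at a time makes (x, y, z) proportional to the cross product; any nonzero
    coordinate of the latter gives the factor. *)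
Lemma cross_span (K : fieldType) (a b c a' b' c' x y z : K) :
  nz (b * c' - c * b') (c * a' - a * c') (a * b' - b * a') ->
  a * x + b * y + c * z = 0 -> a' * x + b' * y + c' * z = 0 ->
  exists k, [/\ x = k * (b * c' - c * b'), y = k * (c * a' - a * c')
              & z = k * (a * b' - b * a')].
Proof.
set n1 := b * c' - _; set n2 := c * a' - _; set n3 := a * b' - _ => n0 e e'.
have e12 : n1 * y = n2 * x.
  apply/eqP; rewrite -subr_eq0; apply/eqP.
  transitivity (c' * (a * x + b * y + c * z) -
                c * (a' * x + b' * y + c' * z)); last first.
    by rewrite e e' !mulr0 subr0.
  by rewrite /n1 /n2; ring.
have e23 : n2 * z = n3 * y.
  apply/eqP; rewrite -subr_eq0; apply/eqP.
  transitivity (a' * (a * x + b * y + c * z) -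
                a * (a' * x + b' * y + c' * z)); last first.
    by rewrite e e' !mulr0 subr0.
  by rewrite /n2 /n3; ring.
have e31 : n3 * x = n1 * z.
  apply/eqP; rewrite -subr_eq0; apply/eqP.
  transitivity (b' * (a * x + b * y + c * z) -
                b * (a' * x + b' * y + c' * z)); last first.
    by rewrite e e' !mulr0 subr0.
  by rewrite /n1 /n3; ring.
move: n1 n2 n3 n0 e12 e23 e31 => n1 n2 n3 n0 e12 e23 e31 {e e'}.
case/or3P: n0 => n0; [exists (x / n1)|exists (y / n2)|exists (z / n3)];
  split; apply/(mulfI n0);
  by [field | rewrite e12; field | rewrite -e12; field | rewrite e23; field
     | rewrite -e23; field | rewrite e31; field | rewrite -e31; field].
Qed.

(** Cramer's rule on two coordinates with a nonzero minor; the equation supplies the third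
    coordinate, and the other minors follow by cyclic symmetry. *)
Lemma cross_comb (K : fieldType) (a b c a' b' c' x y z : K) :
  nz (b * c' - c * b') (c * a' - a * c') (a * b' - b * a') ->
  (b * c' - c * b') * x + (c * a' - a * c') * y + (a * b' - b * a') * z = 0 ->
  exists k k', [/\ x = k * a + k' * a', y = k * b + k' * b'
                 & z = k * c + k' * c'].
Proof.
have solve3 (u v w u' v' w' r s t : K) : u * v' - v * u' != 0 ->
  (v * w' - w * v') * r + (w * u' - u * w') * s + (u * v' - v * u') * t = 0 ->
  exists k k', [/\ r = k * u + k' * u', s = k * v + k' * v'
                 & t = k * w + k' * w'].
  move=> n0 e; exists ((r * v' - s * u') / (u * v' - v * u')).
  exists ((u * s - v * r) / (u * v' - v * u')).
  split; try by field.
  apply/(mulfI n0); apply/eqP; rewrite -subr_eq0 -e; apply/eqP; field.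
  by [].
case/or3P => n0 e.
- have [||k [k' [? ? ?]]] := solve3 b c a b' c' a' y z x;
    rewrite // -?e; last by exists k, k'.
  by ring.
- have [||k [k' [? ? ?]]] := solve3 c a b c' a' b' z x y;
    rewrite // -?e; last by exists k, k'.
  by ring.
- by have [||k [k' [? ? ?]]] := solve3 a b c a' b' c' x y z => //; exists k, k'.
Qed.

(** * Points, lines and the evaluation of the lattice terms in one plane *)

Section Plane.
Variables (K : fieldType) (V : vectType K) (e : 3.-tuple V).
Hypothesis e_basis : basis_of fullv e.
Local Notation A := (subspace_lattice V).

Definition vec a b c : V := a *: e`_0 + b *: e`_1 + c *: e`_2.
Definition pt a b c : A := <[vec a b c]>%VS.

Lemma vecD a b c a' b' c' :
  vec a b c + vec a' b' c' = vec (a + a') (b + b') (c + c').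
Proof. by rewrite /vec !scalerDl addrACA (addrACA (a *: _)). Qed.

Lemma vecZ k a b c : k *: vec a b c = vec (k * a) (k * b) (k * c).
Proof. by rewrite /vec !scalerDr !scalerA. Qed.

Lemma vec_surj v : exists a b c, v = vec a b c.
Proof.
have := coord_basis e_basis (memvf v).
rewrite !big_ord_recl big_ord0 addr0 addrA.
by move=> ->; do 3!eexists.
Qed.

Lemma vec0 : vec 0 0 0 = 0. Proof. by rewrite /vec !scale0r !addr0. Qed.

Lemma vec_eq0 a b c : (vec a b c == 0) = ~~ nz a b c.
Proof.
rewrite /nz !negb_or !negbK.
apply/eqP/and3P => [e0|[/eqP-> /eqP-> /eqP->]]; last exact: vec0.
have /freeP/(_ (fun i => [:: a; b; c]`_i)) := basis_free e_basis.
rewrite !big_ord_recl big_ord0 addr0 addrA => /(_ e0) k0.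
have := k0 (inord 2); have := k0 (inord 1); have := k0 ord0.
by rewrite !inordK //= => -> -> ->.
Qed.

Lemma vec_inj a b c a' b' c' :
  vec a b c = vec a' b' c' -> [/\ a = a', b = b' & c = c'].
Proof.
move=> /eqP; rewrite -subr_eq0 -scaleN1r vecZ vecD vec_eq0.
rewrite /nz !negb_or !negbK !mulN1r !subr_eq0.
by case/and3P => /eqP-> /eqP-> /eqP->.
Qed.

Definition form (a b c : K) (v : V) : K^o :=
  a * coord e ord0 v + b * coord e (inord 1) v + c * coord e (inord 2) v.
Definition ln a b c : A := lker (linfun (form a b c)).

Lemma form_linear a b c : linear (form a b c).
Proof. by move=> k u v; rewrite /form !linearP /= /GRing.scale /=; ring. Qed.

Lemma mem_ln a b c x y z :
  (vec x y z \in (ln a b c : {vspace V})) = (a * x + b * y + c * z == 0).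
Proof.
pose f := HB.pack (form a b c)
  (GRing.isLinear.Build _ _ _ _ _ (form_linear a b c)) : {linear V -> K^o}.
rewrite memv_ker (_ : linfun _ = linfun f) // lfunE /= /form /vec.
have cE (i : 'I_3) j : (j < 3)%N -> coord e i e`_j = (j == i)%:R.
  by move=> j3; rewrite (coord_free (Ordinal j3) i (basis_free e_basis)).
rewrite !linearD !linearZ /=.
by rewrite !cE // !inordK //= /GRing.scale /= !(mulr0, mulr1, addr0, add0r).
Qed.

Lemma mem_pt a b c v :
  reflect (exists k, v = vec (k * a) (k * b) (k * c))
    (v \in (pt a b c : {vspace V})).
Proof. by apply: (iffP (vlineP _ _)) => -[k ->]; exists k; rewrite vecZ. Qed.

Lemma pt_scale k a b c : k != 0 -> pt (k * a) (k * b) (k * c) = pt a b c.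
Proof.
move=> k0; apply/eqP; rewrite /pt -vecZ eqEdim !dim_vline scaler_eq0.
rewrite (negbTE k0) /= leqnn andbT.
by rewrite -memvE memvZ // memv_line.
Qed.

(** The normal vector of the line is orthogonal to both points, hence a nonzero multiple of their
    cross product, and [cross_comb] applies. *)
Lemma join_pt a b c a' b' c' x y z :
  nz x y z -> x * a + y * b + z * c = 0 -> x * a' + y * b' + z * c' = 0 ->
  nz (b * c' - c * b') (c * a' - a * c') (a * b' - b * a') ->
  (pt a b c `|` pt a' b' c')%O = ln x y z.
Proof.
move=> w0 wu wv n0; apply/eqP; change (pt a b c + pt a' b' c' == ln x y z)%VS.
rewrite eqEsubv subv_add -!memvE !mem_ln wu wv eqxx /=.
have [k [ex ey ez]] : exists k, [/\ x = k * (b * c' - c * b'),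
    y = k * (c * a' - a * c') & z = k * (a * b' - b * a')].
  by apply: cross_span => //; [rewrite -[RHS]wu|rewrite -[RHS]wv]; ring.
have k0 : k != 0.
  by apply: contraTneq w0 => k0; rewrite /nz ex ey ez k0 !mul0r eqxx.
apply/subvP => v; have [r [s [t ->]]] := vec_surj v.
rewrite mem_ln => /eqP wt.
have [||m [m' [-> -> ->]]] := @cross_comb K a b c a' b' c' r s t => //.
  by apply/(mulfI k0); rewrite mulr0 -wt ex ey ez; ring.
by rewrite -vecD -!vecZ memv_add ?memvZ ?memv_line.
Qed.

Lemma meet_ln a b c a' b' c' x y z :
  nz x y z -> a * x + b * y + c * z = 0 -> a' * x + b' * y + c' * z = 0 ->
  nz (b * c' - c * b') (c * a' - a * c') (a * b' - b * a') ->
  (ln a b c `&` ln a' b' c')%O = pt x y z.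
Proof.
move=> w0 uw vw n0; apply/eqP; change (ln a b c :&: ln a' b' c' == pt x y z)%VS.
rewrite eqEsubv subv_cap -!memvE !mem_ln uw vw eqxx !andbT.
have [k [ex ey ez]] := cross_span n0 uw vw.
have k0 : k != 0.
  by apply: contraTneq w0 => k0; rewrite /nz ex ey ez k0 !mul0r eqxx.
apply/subvP => v; have [r [s [t ->]]] := vec_surj v.
rewrite memv_cap !mem_ln => /andP[/eqP ut /eqP vt].
have [m [-> -> ->]] := cross_span n0 ut vt.
by apply/mem_pt; exists (m / k); rewrite ex ey ez !mulrA !divfK.
Qed.

Lemma meet_pt (U : A) a b c :
  vec a b c \in (U : {vspace V}) -> (pt a b c `&` U)%O = pt a b c.
Proof.
rewrite memvE => ptU; change (pt a b c :&: U = pt a b c)%VS.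
exact/capv_idPl.
Qed.

Lemma meet_pt0 (U : A) a b c :
  vec a b c \notin (U : {vspace V}) -> (pt a b c `&` U)%O = 0%VS.
Proof.
move=> Uu; apply/eqP; change (pt a b c :&: U == 0)%VS; rewrite -subv0.
apply/subvP => _ /memv_capP[/vlineP[k ->]].
have [->|k0] := eqVneq k 0; first by move=> _; rewrite scale0r mem0v.
by move/(memvZ k^-1); rewrite scalerK // (negbTE Uu).
Qed.

Lemma notin_pt a b c x y z :
  nz (b * z - c * y) (c * x - a * z) (a * y - b * x) ->
  vec a b c \notin (pt x y z : {vspace V}).
Proof.
apply: contraL => /mem_pt[k /vec_inj[-> -> ->]].
rewrite /nz !negb_or !negbK; apply/and3P; split; apply/eqP; ring.
Qed.

Lemma join_ln_full (U : A) a b c x y z :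
  vec x y z \in (U : {vspace V}) -> vec x y z \notin (ln a b c : {vspace V}) ->
  (ln a b c `|` U)%O = fullv.
Proof.
rewrite mem_ln => Uw n0; apply/eqP; rewrite eqEsubv subvf /=.
apply/subvP => v _.
have [r [s [t ->]]] := vec_surj v.
(* [k] is chosen so that subtracting [k] times the given vector moves any vector onto the line. *)
set N := _ + _ in n0; pose k := (a * r + b * s + c * t) / N.
have -> : vec r s t = vec (r - k * x) (s - k * y) (t - k * z) + k *: vec x y z.
  by rewrite vecZ vecD !subrK.
rewrite memv_add ?memvZ // mem_ln; apply/eqP.
transitivity (a * r + b * s + c * t - k * N); first by rewrite /N; ring.
by rewrite /k divfK // subrr.
Qed.

Local Notation e1 := (pt 1 0 0).
Local Notation e2 := (pt 0 1 0).
Local Notation e3 := (pt 0 0 1).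
Local Notation unit_line := (ln 1 1 1).
Local Open Scope order_scope.

Local Ltac side :=
  try by [ rewrite /nz ?(mul0r, mulr0, mul1r, mulr1, subr0, sub0r, addr0, add0r,
             mulrN, mulNr, opprK, oppr_eq0, oner_eq0) ?orbT | ring ].

Lemma join_e12 : e1 `|` e2 = ln 0 0 1.
Proof. by apply: join_pt; side. Qed.

Lemma join_e13 : e1 `|` e3 = ln 0 1 0.
Proof. by apply: join_pt; side. Qed.

Lemma join_e23 : e2 `|` e3 = ln 1 0 0.
Proof. by apply: join_pt; side. Qed.

Lemma meet_l12 : unit_line `&` ln 0 0 1 = pt 1 (-1) 0.
Proof. by apply: meet_ln; side. Qed.

Lemma meet_l13 : unit_line `&` ln 0 1 0 = pt 1 0 (-1).
Proof. by apply: meet_ln; side. Qed.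

Lemma meet_l23 : unit_line `&` ln 1 0 0 = pt 0 1 (-1).
Proof. by apply: meet_ln; side. Qed.

Let joinE :=
  (join_e12, join_e13, join_e23, joinC e2 e1, joinC e3 e1, joinC e3 e2).
Let planeE := (joinE, meet_l12, meet_l13, meet_l23).

Lemma term_move13 a : term_move e1 e2 e3 unit_line (pt 1 a 0) = pt 1 0 a.
Proof.
rewrite /term_move !planeE (@join_pt _ _ _ _ _ _ (- a) 1 1); side.
by apply: meet_ln; side.
Qed.

Lemma term_move23 a : term_move e2 e1 e3 unit_line (pt 1 a 0) = pt 0 a 1.
Proof.
rewrite /term_move !planeE (@join_pt _ _ _ _ _ _ a (-1) a); side.
by apply: meet_ln; side.
Qed.

Lemma term_move21 a : term_move e2 e3 e1 unit_line (pt 0 a 1) = pt 1 a 0.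
Proof.
rewrite /term_move !planeE (@join_pt _ _ _ _ _ _ a (-1) a); side.
by apply: meet_ln; side.
Qed.

(** The line through (1 : a : 0) and (0 : 1 : -1) meets z = bx in (1 : a - b : b), which is
    projected from the third coordinate point. *)
Lemma term_subE a b :
  term_sub e1 e2 e3 unit_line (pt 1 a 0) (pt 1 b 0) = pt 1 (a - b) 0.
Proof.
rewrite /term_sub term_move13 !planeE.
rewrite (@join_pt 1 a 0 _ _ _ (- a) 1 1); side.
rewrite (@join_pt 1 0 b _ _ _ (- b) 0 1); side.
rewrite (@meet_ln _ _ _ _ _ _ 1 (a - b) b); side.
rewrite (@join_pt 1 (a - b) b _ _ _ (a - b) (-1) 0); side.
by apply: meet_ln; side.
Qed.

Lemma meet_coord_lines a b : 
  (pt 1 a 0 `|` e3) `&` (pt 1 0 b `|` e2) = pt 1 a b.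
Proof.
rewrite (@join_pt 1 a 0 _ _ _ a (-1) 0); side.
rewrite (@join_pt 1 0 b _ _ _ b 0 (-1)); side.
by apply: meet_ln; side.
Qed.

(** The point (1 : a : b) is projected from the first coordinate point to (0 : a/b : 1), then moved
    back to the first axis. *)
Lemma term_divE a b : b != 0 ->
  term_div e1 e2 e3 unit_line (pt 1 a 0) (pt 1 b 0) = pt 1 (a / b) 0.
Proof.
move=> b0; rewrite /term_div term_move13 meet_coord_lines !planeE.
rewrite (@join_pt 1 a b _ _ _ 0 b (- a)); side; last first.
- by rewrite /nz !(mulr0, mulr1, mul0r, mul1r, sub0r, subr0, oppr_eq0) b0 ?orbT.
- by rewrite /nz b0 orbT.
rewrite (@meet_ln _ _ _ _ _ _ 0 (a / b) 1); side.
- exact: term_move21.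
- by field.
- by rewrite /nz !(mulr0, mulr1, mul0r, mul1r, sub0r, subr0, oppr_eq0) b0 ?orbT.
Qed.

Local Ltac incidence :=
  rewrite ?mem_ln // ?(mul0r, mulr0, mul1r, mulr1, addr0, add0r, addrN, addNr)
    ?eqxx ?oppr_eq0 ?oner_eq0 //; try by [].

Lemma join0U (U : A) : (0%VS : A) `|` U = U.
Proof. exact: add0v. Qed.

Lemma meetfU (U : A) : (fullv : A) `&` U = U.
Proof. exact: capfv. Qed.

Lemma pt_neq (a b c a' b' c' : K) :
  nz (b * c' - c * b') (c * a' - a * c') (a * b' - b * a') ->
  pt a b c `&` pt a' b' c' = 0%VS.
Proof. by move=> n0; apply/meet_pt0/notin_pt. Qed.

Lemma ln_full a b c x y z : a * x + b * y + c * z != 0 ->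
  ln a b c `|` pt x y z = fullv.
Proof.
by move=> n0; apply: (@join_ln_full _ _ _ _ x y z); rewrite ?memv_line ?mem_ln.
Qed.

(** Joining the point with where the unit line meets each adjacent axis gives that axis, hence the
    other two coordinate points. *)
Lemma term_spread1 : term_spread e1 e2 e3 unit_line e1 = fullv.
Proof.
rewrite /term_spread !planeE.
rewrite !(@join_pt 1 0 0 1 (-1) 0 0 0 1); side.
rewrite !(@join_pt 1 0 0 1 0 (-1) 0 1 0); side.
rewrite ![ln _ _ _ `&` _]meetC !meet_pt; try by incidence.
by rewrite !planeE ln_full //; incidence.
Qed.

Lemma term_spread10 : term_spread e1 e2 e3 unit_line 0%VS = 0%VS.
Proof.
by rewrite /term_spread !planeE !join0U !pt_neq; side; rewrite ?join0U.
Qed.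

Lemma term_spread2 : term_spread e2 e1 e3 unit_line e2 = fullv.
Proof.
rewrite /term_spread !planeE.
rewrite !(@join_pt 0 1 0 1 (-1) 0 0 0 1); side.
rewrite !(@join_pt 0 1 0 0 1 (-1) 1 0 0); side.
rewrite ![ln _ _ _ `&` _]meetC !meet_pt; try by incidence.
by rewrite !planeE ln_full //; incidence.
Qed.

Lemma term_spread20 : term_spread e2 e1 e3 unit_line 0%VS = 0%VS.
Proof.
by rewrite /term_spread !planeE !join0U !pt_neq; side; rewrite ?join0U.
Qed.

(** This and [meet_e2_join_pt] test n = 0 with opposite outcomes, so either of two fields can be the
    one in which a coordinate point survives. *)
Lemma meet_e1_pt n : pt 1 n 0 `&` e1 = if n == 0 then e1 else 0%VS.
Proof.
case: eqVneq => [->|n0]; first exact: meetxx.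
by apply: pt_neq; rewrite /nz !(mulr0, mulr1, sub0r, oppr_eq0) n0 ?orbT.
Qed.

Lemma meet_e2_join_pt n :
  (e1 `|` pt 1 n 0) `&` e2 = if n == 0 then 0%VS else e2.
Proof.
case: eqVneq => [->|n0]; first by rewrite joinxx pt_neq; side.
rewrite (@join_pt 1 0 0 1 n 0 0 0 1); side; last first.
  by rewrite /nz !(mulr0, mul0r, mul1r, subr0) n0 ?orbT.
by rewrite meetC meet_pt; incidence.
Qed.

(** A point off the axis makes [term_sep_axis] collapse to 0, and the rest is the meet of the point
    with the unit line. *)
Lemma term_sep0 (a b c a' b' c' a'' b'' c'' : K) :
  vec a b c \notin (unit_line : {vspace V}) ->
  (pt a b c `&` (pt a' b' c' `|` pt a'' b'' c'')) = 0%VS ->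
  pt a' b' c' `&` pt a'' b'' c'' = 0%VS ->
  term_sep (pt a b c) unit_line (pt a' b' c') (pt a'' b'' c'') = 0%VS.
Proof.
move=> l0 abc0 bc0; rewrite /term_sep /term_sep_axis abc0.
rewrite ![_ `|` (0%VS : A)]joinC !join0U bc0.
rewrite [pt a'' _ _ `&` _]meetC bc0 !join0U.
by rewrite meetC meet_pt0.
Qed.

Lemma term_sep1_0 : term_sep e1 unit_line e2 e3 = 0%VS.
Proof.
apply: term_sep0; first (by incidence); last by apply: pt_neq; side.
by rewrite !planeE meet_pt0 //; incidence.
Qed.

Lemma term_sep2_0 : term_sep e2 unit_line e1 e3 = 0%VS.
Proof.
apply: term_sep0; first (by incidence); last by apply: pt_neq; side.
by rewrite !planeE meet_pt0 //; incidence.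
Qed.

Lemma term_sep3_0 : term_sep e3 unit_line e1 e2 = 0%VS.
Proof.
apply: term_sep0; first (by incidence); last by apply: pt_neq; side.
by rewrite !planeE meet_pt0 //; incidence.
Qed.

(** The unit line meets the axis away from both coordinate points, so [term_sep_axis] is the full
    axis. Joining [e1] gives the plane, whose meet with the unit line is that line; it spans the
    plane together with the axis. *)
Lemma term_sep1_1 : term_sep unit_line e1 e2 e3 = fullv.
Proof.
rewrite /term_sep /term_sep_axis !planeE.
rewrite !(@join_pt 0 1 0 0 1 (-1) 1 0 0); side.
rewrite !(@join_pt 0 0 1 0 1 (-1) 1 0 0); side.
rewrite ![ln _ _ _ `&` pt _ _ _]meetC !meet_pt; try by incidence.
rewrite !planeE ln_full; try by incidence.
rewrite meetfU; apply: (@join_ln_full _ _ _ _ 1 (-1) 0); incidence.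
Qed.

Lemma term_sep2_1 : term_sep unit_line e2 e1 e3 = fullv.
Proof.
rewrite /term_sep /term_sep_axis !planeE.
rewrite !(@join_pt 1 0 0 1 0 (-1) 0 1 0); side.
rewrite !(@join_pt 0 0 1 1 0 (-1) 0 1 0); side.
rewrite ![ln _ _ _ `&` pt _ _ _]meetC !meet_pt; try by incidence.
rewrite !planeE ln_full; try by incidence.
rewrite meetfU; apply: (@join_ln_full _ _ _ _ 1 (-1) 0); incidence.
Qed.

Lemma term_sep3_1 : term_sep unit_line e3 e1 e2 = fullv.
Proof.
rewrite /term_sep /term_sep_axis !planeE.
rewrite !(@join_pt 1 0 0 1 (-1) 0 0 0 1); side.
rewrite !(@join_pt 0 1 0 1 (-1) 0 0 0 1); side.
rewrite ![ln _ _ _ `&` pt _ _ _]meetC !meet_pt; try by incidence.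
rewrite !planeE ln_full; try by incidence.
rewrite meetfU; apply: (@join_ln_full _ _ _ _ 1 0 (-1)); incidence.
Qed.

Lemma plane_generated (K_prime : prime_field K) (T : set A) :
  sublattice T -> T e1 -> T e2 -> T e3 -> T unit_line -> T = setT.
Proof.
move=> subT T1 T2 T3 Tl.
have Tmove := sublattice_move subT.
have T12 : T (pt 1 (-1) 0).
  by have := sublatticeI subT Tl (sublatticeU subT T1 T2); rewrite !planeE.
have TA a : T (pt 1 a 0).
  (* By von Staudt's subtraction and division these coordinates form a subfield, hence all of
     [K]. *)
  pose S := [pred b : K | `[< T (pt 1 b 0) >]].
  suff /K_prime/(_ a) : divring_closed S by rewrite !inE => /asboolP.
  have T_sub b c : T (pt 1 b 0) -> T (pt 1 c 0) -> T (pt 1 (b - c) 0).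
    by move=> Tb Tc; rewrite -term_subE //; apply: sublattice_sub.
  split=> [|b c /asboolP Tb /asboolP Tc|b c /asboolP Tb /asboolP Tc];
    apply/asboolP.
  (* The unit arises as 0 - (-1), both points being available from the frame. *)
  - by have := T_sub 0 (-1) T1 T12; rewrite opprK add0r.
  - exact: T_sub.
  have [->|c0] := eqVneq c 0; first by rewrite invr0 mulr0.
  by rewrite -term_divE //; apply: sublattice_div.
have TB a : T (pt 1 0 a) by rewrite -term_move13 //; apply: Tmove.
have TC a : T (pt 0 a 1) by rewrite -term_move23 //; apply: Tmove.
have TP a b : T (pt 1 a b).
  rewrite -meet_coord_lines //.
  by apply: sublatticeI => //; apply: sublatticeU.
have T0 : T (0%VS : A).
  by have := sublatticeI subT T1 T2; rewrite pt_neq; side.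
have Tline v : T (<[v]>%VS : A).
  have [a [b [c ->]]] := vec_surj v; rewrite -/(pt a b c).
  have [->|a0] := eqVneq a 0; last first.
    have -> : pt a b c = pt 1 (b / a) (c / a); last exact: TP.
    by rewrite -[RHS](@pt_scale a) // mulr1 ![a * _]mulrC !divfK.
  have [->|c0] := eqVneq c 0; last first.
    have -> : pt 0 b c = pt 0 (b / c) 1; last exact: TC.
    by rewrite -[RHS](@pt_scale c) // mulr1 mulr0 [c * _]mulrC divfK.
  have [->|b0] := eqVneq b 0; first by rewrite /pt vec0.
  by rewrite -[b]mulr1 -[0](mulr0 b) pt_scale.
apply/seteqP; split=> // U _.
have -> : U = (\sum_(u <- vbasis U) <[u]>)%VS :> A.
  by rewrite -span_def (span_basis (vbasisP U)).
elim: (tval (vbasis U)) => [|u r IH]; first by rewrite big_nil.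
by rewrite big_cons; apply: (sublatticeU subT).
Qed.

End Plane.

(** * Generation of the product *)

Section ProductGeneration.
Variables (I : Type) (F : I -> fieldType) (V : forall i, vectType (F i)).
Local Notation L := (prod_lattice (fun i => subspace_lattice (V i))).
Implicit Types (S : set L) (i j : I).

Lemma sublattice_proj S i :
  sublattice S ->
  sublattice [set x : subspace_lattice (V i) | exists2 g, S g & g i = x].
Proof.
move=> subS _ _ [g Sg <-] [h Sh <-]; have [SI SU] := subS _ _ Sg Sh.
by split; [exists (g `&` h)%O|exists (g `|` h)%O].
Qed.

(** Finite meets of separating elements are full at one coordinate and 0 elsewhere; meeting with
    them isolates single components, whose finite join is any given element. *)
Lemma sublattice_prod_full S (i0 : I) :
  sublattice S -> finite_set [set: I] ->
  (forall i (x : subspace_lattice (V i)), exists2 g, S g & g i = x) ->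
  (forall i j, i <> j -> exists g, [/\ S g, g i = fullv & g j = 0%VS]) ->
  S = setT.
Proof.
move=> subS fin_I Sproj Ssep.
have [N [f f_surj]] :
    exists N (f : nat -> I), forall i, exists2 k, (k < N)%N & f k = i.
  have [N eqN] := fin_I.
  have : [set: I] #<= `I_N by rewrite (card_le_eql eqN).
  case/pfcard_geP => [|/surjfunPex[f fE]].
    by move=> I0; have : [set: I] i0 by []; rewrite I0.
  exists N, f => i; have : [set: I] i by [].
  by rewrite fE => -[k /= kN <-]; exists k.
have Sdelta i :
    exists s, [/\ S s, s i = fullv & forall j, j <> i -> s j = 0%VS].
  suff [s [Ss si s0]] : exists s, [/\ S s, s i = fullv &
      forall k, (k < N)%N -> f k <> i -> s (f k) = 0%VS].
    by exists s; split=> // j; have [k kN <-] := f_surj j; apply: s0.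
  elim: {f_surj} N => [|N [s [Ss si s0]]].
    by have [s Ss si] := Sproj i fullv; exists s.
  have [fNi|fNi] := pselect (f N = i).
    exists s; split=> // k.
    rewrite ltnS leq_eqVlt => /orP[/eqP->|]; last exact: s0.
    by move=> /(_ fNi).
  have [s' [Ss' s'i s'0]] := Ssep _ _ (nesym fNi).
  exists (s `&` s')%O; split; first exact: sublatticeI.
    by change (s i :&: s' i = fullv)%VS; rewrite si s'i capfv.
  move=> k; rewrite ltnS leq_eqVlt => /orP[/eqP-> _|kN fki].
    by change (s (f N) :&: s' (f N) = 0)%VS; rewrite s'0 capv0.
  by change (s (f k) :&: s' (f k) = 0)%VS; rewrite s0 // cap0v.
apply/seteqP; split=> // g _.
have Spart i : exists h, [/\ S h, (h i = g i) & forall j, (h j <= g j)%VS].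
  have [s [Ss si s0]] := Sdelta i; have [h Sh hi] := Sproj i (g i).
  have hsi : (h `&` s)%O i = g i.
    by change (h i :&: s i = g i)%VS; rewrite si hi capvf.
  exists (h `&` s)%O; split=> // [|j]; first exact: sublatticeI.
  have [->|ji] := pselect (j = i); first by rewrite hsi subvv.
  by change (h j :&: s j <= g j)%VS; rewrite s0 // capv0 sub0v.
have [h [Sh hg gh]] : exists h, [/\ S h, (forall j, (h j <= g j)%VS) &
    forall k, (k < N)%N -> (g (f k) <= h (f k))%VS].
  elim: {f_surj} N => [|N [h [Sh hg gh]]].
    by have [h [Sh _ hg]] := Spart i0; exists h.
  have [h' [Sh' h'N h'g]] := Spart (f N).
  exists (h `|` h')%O; split=> [|j|k]; first exact: sublatticeU.
    by change (h j + h' j <= g j)%VS; rewrite subv_add hg h'g.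
  change ((k < N.+1)%N -> (g (f k) <= h (f k) + h' (f k))%VS).
  rewrite ltnS leq_eqVlt => /orP[/eqP->|kN]; first by rewrite -h'N addvSr.
  by apply: subv_trans (gh k kN) _; apply: addvSl.
suff <- : h = g by [].
apply: functional_extensionality_dep => i; have [k kN <-] := f_surj i.
by apply/eqP; rewrite eqEsubv hg gh.
Qed.

End ProductGeneration.

(* Position [p] holds the line, the others the coordinate points in order. *)
Definition four_gens (K : fieldType) (V : vectType K) (e : 3.-tuple V)
    (p k : nat) : subspace_lattice V :=
  if k == p then ln e 1 1 1 else
  nth (pt e 1 0 0) [:: pt e 1 0 0; pt e 0 1 0; pt e 0 0 1] (unbump p k).

Definition other_two (p q : nat) : nat * nat :=
  let rs := [seq k <- iota 0 4 | (k != p) && (k != q)] in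
  (nth 0 rs 0, nth 0 rs 1).

Lemma other_two_lt4 p q : (p < 4)%N -> (q < 4)%N -> p != q ->
  ((other_two p q).1 < 4)%N /\ ((other_two p q).2 < 4)%N.
Proof. by case: p => [|[|[|[|//]]]]; case: q => [|[|[|[|//]]]]. Qed.

Section FourGens.
Variables (K : fieldType) (V : vectType K) (e : 3.-tuple V).
Hypothesis e_basis : basis_of fullv e.
Variables p q : nat.
Hypotheses (p4 : (p < 4)%N) (q4 : (q < 4)%N) (neq_pq : p != q).
Let r := (other_two p q).1.
Let s := (other_two p q).2.

Lemma four_gens_sep1 :
  term_sep (four_gens e p p) (four_gens e p q)
           (four_gens e p r) (four_gens e p s) = fullv.
Proof.
rewrite /r /s; case: p p4 neq_pq => [|[|[|[|//]]]] _;
  case: q q4 => [|[|[|[|//]]]] _ //= _.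
all: by first [apply: term_sep1_1|apply: term_sep2_1|apply: term_sep3_1].
Qed.

Lemma four_gens_sep0 :
  term_sep (four_gens e q p) (four_gens e q q)
           (four_gens e q r) (four_gens e q s) = 0%VS.
Proof.
rewrite /r /s; case: p p4 neq_pq => [|[|[|[|//]]]] _;
  case: q q4 => [|[|[|[|//]]]] _ //= _.
all: by first [apply: term_sep1_0|apply: term_sep2_0|apply: term_sep3_0].
Qed.

End FourGens.

(** * Four generators of the product *)

Section Sufficiency.
Variables (I : Type) (F : I -> fieldType) (V : forall i, vectType (F i)).
Variables (e : forall i, 3.-tuple (V i)) (pi : I -> nat).
Hypothesis F_prime : forall i, prime_field (F i).
Hypothesis e_basis : forall i, basis_of fullv (e i).
Hypothesis pi_lt4 : forall i, (pi i < 4)%N.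
Hypothesis pi_inj : forall i j, pi i = pi j -> same_char (F i) (F j) -> i = j.
Local Notation L := (prod_lattice (fun i => subspace_lattice (V i))).

Definition prod_gens (k : nat) : L := fun i => four_gens (e i) (pi i) k.

Section Generated.
Variable S : set L.
Hypothesis subS : sublattice S.
Hypothesis S_gens : forall k, (k < 4)%N -> S (prod_gens k).

(** The same four elements serve as a frame at all coordinates of position [p], so one term can be
    evaluated at all of them. *)
Lemma prod_frame p : (p < 4)%N ->
  exists E1 E2 E3 Lg : L, [/\ S E1, S E2, S E3, S Lg &
    forall i, pi i = p ->
    [/\ E1 i = pt (e i) 1 0 0, E2 i = pt (e i) 0 1 0, E3 i = pt (e i) 0 0 1
      & Lg i = ln (e i) 1 1 1]].
Proof.
move=> p4; exists (prod_gens (bump p 0)), (prod_gens (bump p 1)).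
exists (prod_gens (bump p 2)), (prod_gens p).
by case: p p4 => [|[|[|[|//]]]] _; split; try (by apply: S_gens);
   move=> i pi_i; rewrite /prod_gens pi_i.
Qed.

Lemma prod_proj i (x : subspace_lattice (V i)) : exists2 g, S g & g i = x.
Proof.
have [E1 [E2 [E3 [Lg [S1 S2 S3 SL E]]]]] := prod_frame (pi_lt4 i).
have [e1 e2 e3 l] := E i erefl.
have /seteqP[_ /(_ x)] := plane_generated (e_basis i) (@F_prime i)
  (sublattice_proj (i := i) subS) (ex_intro2 _ _ E1 S1 e1)
  (ex_intro2 _ _ E2 S2 e2) (ex_intro2 _ _ E3 S3 e3) (ex_intro2 _ _ Lg SL l).
exact.
Qed.

(** Generator [pi i] is the line at [i] and a coordinate point at [j]; for generator [pi j] it is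
    the reverse. *)
Lemma prod_sep_position i j : pi i != pi j ->
  exists g, [/\ S g, g i = fullv & g j = 0%VS].
Proof.
move=> neq_pi; pose rs := other_two (pi i) (pi j).
exists (term_sep (prod_gens (pi i)) (prod_gens (pi j))
                 (prod_gens rs.1) (prod_gens rs.2)).
have [r4 s4] := other_two_lt4 (pi_lt4 i) (pi_lt4 j) neq_pi.
split; first by apply: sublattice_sep => //; apply: S_gens.
- exact: four_gens_sep1.
- exact: four_gens_sep0.
Qed.

Lemma prod_sep_char i j : pi i = pi j -> i <> j ->
  exists g, [/\ S g, g i = fullv & g j = 0%VS].
Proof.
move=> eq_pi neq_ij.
have [n neq_n] : exists n, (n%:R == 0 :> F i) != (n%:R == 0 :> F j).
  apply: contrapT => /forallNP same; apply: neq_ij; apply: pi_inj => // n.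
  by have /negP := same n; rewrite negbK => /eqP.
have [E1 [E2 [E3 [Lg [S1 S2 S3 SL E]]]]] := prod_frame (pi_lt4 i).
have [e1i e2i e3i li] := E i erefl; have [e1j e2j e3j lj] := E j (esym eq_pi).
have [A [SA Ai Aj]] : exists A : L,
    [/\ S A, A i = pt (e i) 1 n%:R 0 & A j = pt (e j) 1 n%:R 0].
  elim: {neq_n} n => [|n [A [SA Ai Aj]]]; first by exists E1.
  (* The successor of n is n - (-1), with (1 : -1 : 0) as second point. *)
  exists (term_sub E1 E2 E3 Lg A (Lg `&` (E1 `|` E2))%O); split.
  - apply: sublattice_sub => //; apply: sublatticeI => //.
    exact: sublatticeU.
  - change (term_sub (E1 i) (E2 i) (E3 i) (Lg i) (A i)
              (Lg i `&` (E1 i `|` E2 i))%O = pt (e i) 1 n.+1%:R 0).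
    rewrite e1i e2i e3i li Ai join_e12 // meet_l12 // term_subE //.
    by rewrite opprK natr1.
  change (term_sub (E1 j) (E2 j) (E3 j) (Lg j) (A j)
            (Lg j `&` (E1 j `|` E2 j))%O = pt (e j) 1 n.+1%:R 0).
  rewrite e1j e2j e3j lj Aj join_e12 // meet_l12 // term_subE //.
  by rewrite opprK natr1.
have [n0|n0] := boolP (n%:R == 0 :> F i).
  exists (term_spread E1 E2 E3 Lg (A `&` E1)%O); split.
  - by apply: sublattice_spread => //; apply: sublatticeI.
  - change (term_spread (E1 i) (E2 i) (E3 i) (Lg i) (A i `&` E1 i)%O = fullv).
    by rewrite e1i e2i e3i li Ai meet_e1_pt // n0 term_spread1.
  change (term_spread (E1 j) (E2 j) (E3 j) (Lg j) (A j `&` E1 j)%O = 0%VS).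
  move: neq_n; rewrite n0 eq_sym eqb_id => nj.
  by rewrite e1j e2j e3j lj Aj meet_e1_pt // (negbTE nj) term_spread10.
exists (term_spread E2 E1 E3 Lg ((E1 `|` A) `&` E2)%O); split.
- apply: sublattice_spread => //; apply: sublatticeI => //.
  exact: sublatticeU.
- change (term_spread (E2 i) (E1 i) (E3 i) (Lg i)
            ((E1 i `|` A i) `&` E2 i)%O = fullv).
  by rewrite e1i e2i e3i li Ai meet_e2_join_pt // (negbTE n0) term_spread2.
change (term_spread (E2 j) (E1 j) (E3 j) (Lg j)
          ((E1 j `|` A j) `&` E2 j)%O = 0%VS).
have nj : n%:R == 0 :> F j.
  by move: neq_n; rewrite (negbTE n0) eq_sym eqbF_neg negbK.
by rewrite e1j e2j e3j lj Aj meet_e2_join_pt // nj term_spread20.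
Qed.

End Generated.

Lemma prod_gens_generating (i0 : I) : finite_set [set: I] ->
  generating (prod_gens @` `I_4).
Proof.
move=> fin_I S subS S_gens.
have S_gens' k : (k < 4)%N -> S (prod_gens k).
  by move=> k4; apply: S_gens; exists k.
apply: (sublattice_prod_full i0) => // [|i j neq_ij].
  exact: (prod_proj subS S_gens').
have [eq_pi|neq_pi] := eqVneq (pi i) (pi j).
  exact: (prod_sep_char subS S_gens').
exact: (prod_sep_position subS S_gens').
Qed.

End Sufficiency.

(** Each characteristic class gets one representative, whose injection is used for all its members;
    injections chosen index by index would not agree. *)
Lemma class_injection (I : Type) (F : I -> fieldType) (i0 : I) :
  (forall i, prime_field (F i)) ->
  (forall K : fieldType, prime_field K ->
     [set i | field_isomorphic (F i) K] #<= `I_4) ->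
  exists pi : I -> nat, (forall i, (pi i < 4)%N) /\
    forall i j, pi i = pi j -> same_char (F i) (F j) -> i = j.
Proof.
move=> F_prime F_le4.
have class_inj r : exists f : I -> nat,
    (forall i, field_isomorphic (F i) (F r) -> (f i < 4)%N) /\
    {in [set i | field_isomorphic (F i) (F r)] &, injective f}.
  have [f f4 f_inj] := card_le_injfun 0%N (F_le4 _ (@F_prime r)).
  by exists f.
have [f f_inj] := choice class_inj.
have pick_class (C : set I) : exists i, C !=set0 -> C i.
  by have [[i Ci]|C0] := pselect (C !=set0); [exists i|exists i0].
have [pick pickP] := choice pick_class.
pose rep i := pick [set j | same_char (F j) (F i)].
have rep_iso i : field_isomorphic (F i) (F (rep i)).
  apply: same_char_isomorphic => // n; apply: esym.
  by apply: (pickP [set j | same_char (F j) (F i)]); exists i.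
exists (fun i => f (rep i) i); split=> [i|i j + ij].
  by have [+ _] := f_inj (rep i); apply; apply: rep_iso.
(* The two classes are equal as sets, so [pick] returns the same index. *)
have -> : rep j = rep i.
  congr pick; apply/seteqP; split=> k /= k_ n; first by rewrite k_ -ij.
  by rewrite k_ ij.
move=> eq_f; have [_ inj_i] := f_inj (rep i); apply: inj_i eq_f; rewrite inE /=.
  exact: rep_iso.
have -> : rep i = rep j; last exact: rep_iso.
congr pick; apply/seteqP; split=> k /= k_ n; first by rewrite k_ ij.
by rewrite k_ -ij.
Qed.

Lemma ex_frame (K : fieldType) (V : vectType K) :
  \dim {:V} = 3%N -> exists e : 3.-tuple V, basis_of fullv e.
Proof.
move=> dimV; have : exists e : (\dim {:V}).-tuple V, basis_of fullv e.
  by exists (vbasis fullv); apply: vbasisP.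
by rewrite dimV.
Qed.

Local Close Scope ring_scope.

Theorem theorem3p3 (lambda : Type) (le_lambda : rel lambda)
  (lambda_wo : wochoice.well_order le_lambda)
  (lambda_neq0 : [set: lambda] !=set0)
  (F : lambda -> fieldType)
  (F_prime : forall i, prime_field (F i))
  (V : forall i, vectType (F i))
  (V_dim3 : forall i, \dim (fullv : {vspace V i}) = 3) :
  fmng_eq (prod_lattice (fun i => subspace_lattice (V i))) 4 <->
  [/\ finite_set [set: lambda],
      [set: lambda] !=set0 &
      forall K : fieldType, prime_field K ->
        [set i | field_isomorphic (F i) K] #<= `I_4].
Proof.
have [i0 _] := lambda_neq0; split.
  by move=> /(fmng4_necessary V_dim3 i0)[fin_lambda F_le4]; split.
move=> [fin_lambda _ F_le4].
have [pi [pi_lt4 pi_inj]] := class_injection i0 F_prime F_le4.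
pose e i := projT1 (cid (ex_frame (V_dim3 i))).
have e_basis i : basis_of fullv (e i) := projT2 (cid (ex_frame (V_dim3 i))).
have genX := prod_gens_generating F_prime e_basis pi_lt4 pi_inj i0 fin_lambda.
split; last by move=> X; apply: generating_card_ge4 V_dim3 i0 _.
exists (prod_gens e pi @` `I_4) => //.
(* The lower bound for generating sets shows that the four generators are distinct. *)
by rewrite card_eq_le card_image_le (generating_card_ge4 V_dim3 i0 genX).
Qed.
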